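(* Let $t\in[0,1)$ and let $X$ be any (LB)-space in $\{\ell(p-),ces(p-),d(p-):1<p\le\infty\}$. (i) The right-shift operator $S$ maps $X$ into $X$ and belongs to $\mathcal{L}(X)$. (ii) The generalized Cesàro operator $C_t$ maps $X$ into $X$ and satisfies $C_t\in\mathcal{L}(X)$. (iii) The operator $R_t$ maps $X$ into $X$ and belongs to $\mathcal{L}(X)$, with the series $\sum_{n=0}^\infty t^nS^n$ being convergent in $\mathcal{L}_s(X)$. Moreover, $$C_t=D_\varphi R_t=\sum_{n=0}^\infty t^nD_\varphi S^n.$$
   Context: $\mathbb{N}_0=\{0,1,2,\dots\}$ and $\omega:=\mathbb{C}^{\mathbb{N}_0}$ with the topology of coordinatewise convergence. For $t\in[0,1]$, $C_tx:=\left(\frac{t^nx_0+t^{n-1}x_1+\dots+x_n}{n+1}\right)_{n\in\mathbb{N}_0}$ for $x\in\omega$ (with $0^0:=1$). On $\omega$ define $D_\varphi x:=\left(\frac{x_n}{n+1}\right)_{n\in\mathbb{N}_0}$ (where $\varphi:=(\frac1{n+1})_{n\in\mathbb{N}_0}$), the right-shift $Sx:=(0,x_0,x_1,\dots)$, and, for $t\in[0,1)$, $R_t:=\sum_{n=0}^\infty t^nS^n$, the series being absolutely convergent in $\mathcal{L}_s(\omega)$. All operators act on sequence spaces $X\subseteq\omega$ by restriction. Banach spaces: $\ell^q=\ell^q(\mathbb{N}_0)$ with its usual norm $\|\cdot\|_q$; $ces(q):=\{x\in\omega: C_1|x|\in\ell^q\}$ with norm $\|x\|_{ces(q)}:=\|C_1|x|\,\|_q$,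 where $|x|=(|x_n|)_n$; $d_q:=\{x\in\ell^\infty:\hat x\in\ell^q\}$ with norm $\|x\|_{d_q}:=\|\hat x\|_q$, where $\hat x:=(\sup_{k\ge n}|x_k|)_{n\in\mathbb{N}_0}$; here $1<q<\infty$. (LB)-spaces: for $1<p\le\infty$ and a strictly increasing sequence $(p_k)_{k\in\mathbb{N}}\subseteq(1,p)$ with $p_k\uparrow p$, $\ell(p-):=\mathrm{ind}_k\,\ell^{p_k}$, $ces(p-):=\mathrm{ind}_k\,ces(p_k)$, $d(p-):=\mathrm{ind}_k\,d_{p_k}$, i.e. the union of the respective Banach spaces with the finest locally convex topology making all their inclusions continuous. $\mathcal{L}(X)$ is the space of continuous linear operators on $X$ and $\mathcal{L}_s(X)$ is $\mathcal{L}(X)$ with the topology of pointwise convergence on $X$ (strong operator topology). *)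

(* Defs.v *)
(* MathComp-Analysis; scalars are the complex numbers R[i] over R : realType.   *)
From HB Require Import structures.
From mathcomp Require Import all_boot all_order all_algebra.
From mathcomp Require Import all_classical all_reals all_analysis.
From mathcomp Require Import complex.

Set Implicit Arguments.
Unset Strict Implicit.
Unset Printing Implicit Defensive.

Import Order.TTheory GRing.Theory Num.Theory.
Import numFieldNormedType.Exports.
Import Normc.

Local Open Scope classical_set_scope.
Local Open Scope complex_scope.
Local Open Scope ring_scope.

Definition absconvex (K : numFieldType) (V : lmodType K) (W : set V) :=
  forall (a b : K) (u v : V), W u -> W v -> `|a| + `|b| <= 1 ->
    W (a *: u + b *: v).

Definition absorbing (K : numFieldType) (V : lmodType K) (W : set V) :=
  forall v : V, exists2 c : K, c != 0 & W (c *: v).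

(* The space V with the finest locally convex topology making every i k        *)
(* continuous. `tvsType` is the library's structure of locally convex spaces.  *)
Definition indlim (K : numFieldType) (V : lmodType K) (E : nat -> tvsType K)
  (i : forall k, {linear E k -> V}) : Type := V.

Section indlim_topology.
Context (K : numFieldType) (V : lmodType K) (E : nat -> tvsType K).
Variable i : forall k, {linear E k -> V}.
Local Notation L := (indlim i).

HB.instance Definition _ := GRing.Lmodule.on L.

(* Basic neighbourhoods of 0: the absolutely convex absorbing sets whose       *)
(* preimages are neighbourhoods of 0 in all the steps.                         *)
Definition indlim_nbhs0 (W : set L) :=
  [/\ absconvex W, absorbing W & forall k, nbhs 0 (i k @^-1` W)].

Definition indlim_nbhs (x : L) : set_system L :=
  [set A | exists2 W, indlim_nbhs0 W & forall w, W w -> A (x + w)].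

HB.instance Definition _ := hasNbhs.Build L indlim_nbhs.

Lemma absconvexZ (W : set L) (c : K) v : absconvex W -> W v -> `|c| <= 1 ->
  W (c *: v).
Proof.
by move=> cW Wv c1; rewrite -[c *: v]addr0 -(scale0r v); apply: cW => //;
  rewrite normr0 addr0.
Qed.

Lemma indlim_nbhs0_0 (W : set L) : indlim_nbhs0 W -> W 0.
Proof.
case=> cW aW _; have [c _ Wc] := aW 0.
by rewrite -(scale0r (c *: 0)); apply: absconvexZ => //; rewrite normr0 ler01.
Qed.

Lemma indlim_nbhs0I (A B : set L) :
  indlim_nbhs0 A -> indlim_nbhs0 B -> indlim_nbhs0 (A `&` B).
Proof.
move=> [cA aA nA] [cB aB nB]; split.
- by move=> a b u v [Au Bu] [Av Bv] ab; split; [exact: cA|exact: cB].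
- move=> v; have [c c0 Acv] := aA v; have [d d0 Bdv] := aB v.
  have cd0 : 0 < `|c| + `|d| by rewrite ltr_wpDr ?normr_gt0.
  exists (c * d / (`|c| + `|d|)).
    by rewrite !mulf_neq0// invr_neq0// gt_eqF.
  split.
    rewrite (_ : c * d / _ *: v = (d / (`|c| + `|d|)) *: (c *: v)); last first.
      by rewrite scalerA mulrAC [d / _ * c]mulrC mulrA mulrAC.
    apply: absconvexZ => //.
    by rewrite normrM normfV (gtr0_norm cd0) ler_pdivrMr// mul1r lerDr.
  rewrite (_ : c * d / _ *: v = (c / (`|c| + `|d|)) *: (d *: v)); last first.
    by rewrite scalerA mulrAC.
  apply: absconvexZ => //.
  by rewrite normrM normfV (gtr0_norm cd0) ler_pdivrMr// mul1r lerDl.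
- by move=> k; rewrite preimage_setI; exact: filterI.
Qed.

Lemma indlim_nbhs0Z (c : K) (W : set L) : c != 0 ->
  indlim_nbhs0 W -> indlim_nbhs0 [set v | W (c *: v)].
Proof.
move=> c0 [cW aW nW]; split.
- move=> a b u v /= Wu Wv ab.
  by rewrite scalerDr !scalerA ![c * _]mulrC -!scalerA; exact: cW.
- move=> v; have [d d0 Wdv] := aW v; exists (d / c) => [|/=].
    by rewrite mulf_neq0 ?invr_neq0.
  by rewrite scalerA mulrCA mulfV// mulr1.
- move=> k.
  have := nbhs0Z (invr_neq0 c0) (nW k); apply: filterS => _ [u Wu <-] /=.
  by rewrite linearZ/= scalerA mulfV// scale1r.
Qed.

Lemma indlim_nbhs0T : indlim_nbhs0 setT.
Proof.
split=> // [v|k]; first by exists 1 => //; exact: oner_neq0.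
by rewrite preimage_setT; exact: filter_nbhsT.
Qed.

Lemma indlim_half (W : set L) : indlim_nbhs0 W ->
  exists2 W', indlim_nbhs0 W' & forall u v, W' u -> W' v -> W (u + v).
Proof.
move=> gW; have two0 : 2 != 0 :> K by rewrite pnatr_eq0.
exists [set v | W (2 *: v)]; first exact: indlim_nbhs0Z.
move=> u v /= Wu Wv.
rewrite -[u](scalerK two0) -[v](scalerK two0); case: gW => cW _ _.
apply: cW => //; rewrite normfV (ger0_norm (ler0n _ _)).
by rewrite -mulr2n -(mulr_natl 2^-1) mulfV.
Qed.

Lemma indlim_filter (x : L) : ProperFilter (nbhs x).
Proof.
apply: Build_ProperFilter_ex => [A [W gW WA]|].
  by exists (x + 0); apply: WA; exact: indlim_nbhs0_0.
split; first by exists setT => //; exact: indlim_nbhs0T.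
- move=> A B [W gW WA] [U gU UB]; exists (W `&` U); first exact: indlim_nbhs0I.
  by move=> w [Ww Uw]; split; [exact: WA|exact: UB].
- by move=> A B AB [W gW WA]; exists W => // w /WA; exact: AB.
Qed.

Lemma indlim_singleton (x : L) (A : set L) : nbhs x A -> A x.
Proof. by case=> W gW WA; rewrite -[x]addr0; apply: WA; exact: indlim_nbhs0_0. Qed.

Lemma indlim_nbhs_nbhs (x : L) (A : set L) : nbhs x A -> nbhs x (nbhs^~ A).
Proof.
case=> W gW WA; have [W' gW' W'W] := indlim_half gW.
exists W' => // w W'w; exists W' => // w' W'w'.
by rewrite -addrA; apply: WA; exact: W'W.
Qed.

HB.instance Definition _ := Nbhs_isNbhsTopological.Build L
  indlim_filter indlim_singleton indlim_nbhs_nbhs.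

Lemma indlim_add_continuous : continuous (fun x : L * L => x.1 + x.2).
Proof.
move=> [x y] A [W gW WA]; have [W' gW' W'W] := indlim_half gW.
exists ([set x + w | w in W'], [set y + w | w in W']).
  by split; exists W' => // w W'w; exists w.
move=> [_ _] [/= [u W'u <-] [v W'v <-]].
by rewrite addrACA; apply: WA; exact: W'W.
Qed.

Lemma indlim_scale_continuous : continuous (fun z : K^o * L => z.1 *: z.2).
Proof.
move=> [/= a x] A [W gW WA]; have [W' gW' W'W] := indlim_half gW.
have [c c0 W'cx] : exists2 c : K, c != 0 & W' (c *: x) by case: gW' => _ + _.
have M0 : 0 < `|a| + `|c| by rewrite ltr_wpDl ?normr_gt0.
exists (ball a `|c|, [set x + w | w in [set v | W' ((`|a| + `|c|) *: v)]]).
  split; first by apply: nbhsx_ballx; rewrite normr_gt0.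
  exists [set v | W' ((`|a| + `|c|) *: v)]; last by move=> w ?; exists w.
  by apply: indlim_nbhs0Z => //; rewrite gt_eqF.
move=> [b _] [/= bac [w W'w <-]].
rewrite -ball_normE/= in bac.
have -> : b *: (x + w) = a *: x + ((b - a) *: x + b *: w).
  by rewrite scalerDr addrA -scalerDl subrKC.
have [cW' _ _] := gW'.
apply: WA; apply: W'W.
  rewrite -[x](scalerK c0) scalerA; apply: absconvexZ => //.
  by rewrite normrM normfV ler_pdivrMr ?normr_gt0// mul1r distrC ltW.
have M1 : `|a| + `|c| != 0 by rewrite gt_eqF.
rewrite -[w](scalerK M1) scalerA; apply: absconvexZ => //.
rewrite normrM normfV (gtr0_norm M0) ler_pdivrMr// mul1r.
rewrite -{1}(subrKC a b) (le_trans (ler_normD _ _))// lerD2l.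
by rewrite distrC ltW.
Qed.

Lemma indlim_locally_convex : exists2 B : set_system L,
  (forall b, b \in B -> convex_set b) & basis B.
Proof.
exists [set B : set L | open B /\ convex_set B] => [b|].
  by rewrite inE => -[].
split; first by move=> b [].
move=> x A [W gW WA]; exists (interior [set x + w | w in W]).
  split; last first.
    by rewrite /interior/=; exists W => // w Ww; exists w.
  split; first exact: open_interior.
  move=> u v l; rewrite !inE /interior/= => -[U gU Uu] [U' gU' Uv].
  exists (U `&` U'); first exact: indlim_nbhs0I.
  move=> w [Uw U'w]; have [u' Wu' uE] := Uu _ Uw; have [v' Wv' vE] := Uv _ U'w.
  have [cW _ _] := gW.
  exists (l%:num *: u' + (1 - l%:num) *: v').
    apply: cW => //.
    by rewrite !ger0_norm ?subr_ge0// subrKC.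
  have {1}-> : x = l%:num *: x + (1 - l%:num) *: x.
    by rewrite -scalerDl subrKC scale1r.
  rewrite addrACA -!scalerDr uE vE !scalerDr addrACA -scalerDl subrKC.
  by rewrite scale1r.
by apply: subset_trans (@interior_subset _ _) _ => _ [w /WA ? <-].
Qed.

(* This factory provides only the uniform structure, so the remaining mixins   *)
(* are given separately.                                                       *)
HB.instance Definition _ := PreTopologicalLmod_isTvs.Build K L
  indlim_add_continuous indlim_scale_continuous indlim_locally_convex.
HB.instance Definition _ := PreTopologicalNmodule_isTopologicalNmodule.Build L
  indlim_add_continuous.
HB.instance Definition _ := TopologicalNmodule_isTopologicalLmodule.Build K L
  indlim_scale_continuous.
HB.instance Definition _ := Uniform_isTvs.Build K L indlim_locally_convex.

Lemma indlim_in_continuous k : continuous (i k : E k -> L).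
Proof.
move=> x A [W [_ _ nW] WA].
have /= := nbhsT x (nW k); apply: filterS => _ [y Wy <-] /=.
by rewrite linearD; exact: WA.
Qed.

End indlim_topology.

Section indlim_universal.
Context (K : numFieldType) (V : lmodType K) (E : nat -> tvsType K).
Variable i : forall k, {linear E k -> V}.

(* Universal property. When F is V with another locally convex topology making *)
(* all the i k continuous, f := id shows that the topology of indlim is finer. *)
Lemma indlim_continuous (F : tvsType K) (f : {linear V -> F}) :
  (forall v, exists k u, v = i k u) ->
  (forall k, continuous (f \o i k)) -> continuous (f : indlim i -> F).
Proof.
move=> iV fi x A /= nA.
have [B Bconv [Bop Bbase]] := @locally_convex K F.
have : nbhs 0 [set y | A (f x + y)].
  have := nbhsB (- f x) nA; rewrite addNr; apply: filterS => _ [y Ay <-] /=.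
  by rewrite addrA subrr add0r.
move=> /Bbase [b [Bb b0] bA].
have {}Bconv := Bconv _ (mem_set Bb).
have nb : nbhs (0 : F) b by apply: open_nbhs_nbhs; split=> //; exact: Bop.
pose D := [set y : F | forall c : K, `|c| <= 1 -> b (c *: y)].
have bC (l : K) u v : 0 <= l <= 1 -> b u -> b v -> b (l *: u + (1 - l) *: v).
  move=> /andP[l0 l1] bu bv.
  by have := Bconv u v (Itv01 l0 l1) (mem_set bu) (mem_set bv); rewrite inE.
have nD : nbhs (0 : F) D.
  have /= := @scale_continuous K F (0, 0) b; rewrite scaler0.
  move=> /(_ nb) [[/= P Q] [nP nQ] PQb].
  have [e /= e0 eP] := nP.
  pose r : K := e / 2.
  have r0 : 0 < r by rewrite divr_gt0.
  have := nbhs0Z (lt0r_neq0 r0) nQ; apply: filterS => _ [y Qy <-] c c1.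
  rewrite scalerA; apply: (PQb (_, y)); split => //=; apply: eP => /=.
  rewrite sub0r normrN normrM (gtr0_norm r0) (@le_lt_trans _ _ r)//.
    by rewrite ler_piMl// ltW.
  by rewrite /r ltr_pdivrMr// ltr_pMr// ltr1n.
exists (f @^-1` D); last first.
  move=> w /(_ 1); rewrite normr1 scale1r lexx => /(_ isT)/bA.
  by rewrite /= linearD.
split.
- move=> a c u v /= Du Dv ac d d1.
  pose s := `|a| + `|c|; pose phase (z : K) := z / `|z|.
  have phaseE z : `|z| * phase z = z.
    by have [->|z0] := eqVneq z 0; rewrite ?normr0 ?mul0r// mulrC divfK ?normr_eq0.
  have phase1 z : `|phase z| <= 1.
    rewrite normrM normfV normr_id; have [->|z0] := eqVneq z 0.
      by rewrite normr0 mul0r.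
    by rewrite mulfV ?normr_eq0.
  have s0 : 0 <= s by rewrite addr_ge0.
  have [sE|s_neq0] := eqVneq s 0.
    have /eqP := sE; rewrite paddr_eq0// !normr_eq0 => /andP[/eqP-> /eqP->].
    by rewrite !scale0r addr0 linear0 scaler0.
  have s_gt0 : 0 < s by rewrite lt_def s_neq0.
  have lE : 1 - `|a| / s = `|c| / s.
    by rewrite -[X in X - _](mulfV s_neq0) -mulrBl addrC addKr.
  have -> : d *: f (a *: u + c *: v) =
      (`|a| / s) *: ((d * s * phase a) *: f u) +
      (1 - `|a| / s) *: ((d * s * phase c) *: f v).
    have cE z w : d *: (z *: w) = (`|z| / s) *: ((d * s * phase z) *: w) :> F.
      rewrite !scalerA -{1}(phaseE z); congr (_ *: w).
      move: (phase z) `|z| => y q; rewrite [d * s]mulrC !mulrA divfK//.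
      by rewrite [d * q]mulrC.
    by rewrite lE -!cE linearD 2!linearZ_LR scalerDr.
  apply: bC.
  - by rewrite divr_ge0//= ler_pdivrMr// mul1r lerDl.
  - apply: Du; rewrite (normrM (d * s)) (normrM d) (ger0_norm s0).
    apply: mulr_ile1 => //; first by rewrite mulr_ge0.
    exact: mulr_ile1.
  - apply: Dv; rewrite (normrM (d * s)) (normrM d) (ger0_norm s0).
    apply: mulr_ile1 => //; first by rewrite mulr_ge0.
    exact: mulr_ile1.
- move=> v; have /= := @scale_continuous K F (0, f v) D; rewrite scale0r.
  move=> /(_ nD) [[/= P Q] [[e /= e0 eP] nQ] PQD].
  exists (e / 2); first by rewrite mulf_neq0 ?gt_eqF.
  rewrite /= linearZ; apply: (PQD (_, f v)); split; last exact: nbhs_singleton.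
  apply: eP; rewrite /= sub0r normrN gtr0_norm ?divr_gt0//.
  by rewrite ltr_pdivrMr// ltr_pMr// ltr1n.
- move=> k; apply: (fi k 0); rewrite /= !linear0.
  exact: nD.
Qed.
End indlim_universal.

(* C^N with the topology of coordinatewise convergence *)
Definition omega (R : realType) : Type := nat -> R[i]^o.

HB.instance Definition _ (R : realType) := GRing.Lmodule.copy (omega R)
  (nat -> R[i]^o).
HB.instance Definition _ (R : realType) := Topological.copy (omega R)
  {ptws nat -> R[i]^o}.
HB.instance Definition _ (R : realType) := isPointed.Build (omega R) 0.

Section operators.
Context (R : realType).
Implicit Types (t : R) (x : omega R).

(* C_t; `^+` follows the convention 0 ^+ 0 = 1 *)
Definition Cop t x : omega R :=
  fun n => (\sum_(i < n.+1) t%:C ^+ (n - i) * x i) / n.+1%:R.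

(* D_phi *)
Definition Dop x : omega R := fun n => x n / n.+1%:R.

(* the right shift S *)
Definition Sop x : omega R := fun n => if n is m.+1 then x m else 0.

(* R_t x is the sum in omega of the series of the t^n S^n x *)
Definition Rop t x : omega R :=
  lim ((fun N => \sum_(n < N) t%:C ^+ n *: iter n Sop x) @ \oo).

Definition sabs x : omega R := fun n => `|x n|.

(* \hat x; meaningful for bounded x only, since `sup` is total on sets of reals *)
Definition tail_sup x : omega R :=
  fun n => (sup [set normc (x k) | k in [set k | (n <= k)%N]])%:C.

End operators.

Section norms.
Context (R : realType).
Implicit Types (q a : R) (x y z : omega R).

(* (\sum_n |x_n|^q)^(1/q), possibly +oo, see lnormE; `normc` is the R-valued   *)
(* modulus, whereas `|c| is in R[i].                                           *)
Definition lnorm q x : \bar R :=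
  Lnorm counting q%:E (fun n => (normc (x n))%:E).

Lemma normc_ge0 (c : R[i]) : 0 <= normc c.
Proof. by case: c => a b; exact: sqrtr_ge0. Qed.

Lemma ler_normcD (c d : R[i]) : normc (c + d) <= normc c + normc d.
Proof. exact: le_normcD. Qed.

Lemma normc_norm (c : R[i]) : normc `|c| = normc c.
Proof.
change (normc (normc c)%:C = normc c).
by rewrite /= expr0n addr0 sqrtr_sqr ger0_norm// normc_ge0.
Qed.

Lemma normc_real a : normc (a%:C) = `|a|.
Proof. by rewrite /= expr0n addr0 sqrtr_sqr. Qed.

Lemma lnorm_ge0 q x : (0 <= lnorm q x)%E.
Proof. exact: Lnorm_ge0. Qed.

Lemma lnormE q x : 0 < q ->
  lnorm q x = poweR (\sum_(k <oo) (normc (x k) `^ q)%:E) q^-1.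
Proof.
move=> q0; rewrite /lnorm Lnorm_counting//; congr poweR.
by apply: eq_eseriesr => k _; rewrite /= ger0_norm ?normc_ge0.
Qed.

Let nneg_terms q x k : (0 <= (normc (x k) `^ q)%:E)%E.
Proof. by rewrite lee_fin powR_ge0. Qed.

Lemma lnorm_lty q x : 0 < q ->
  ((lnorm q x < +oo) = (\sum_(k <oo) (normc (x k) `^ q)%:E < +oo))%E.
Proof.
move=> q0; rewrite lnormE//; apply/idP/idP; last exact: poweR_lty.
by apply: lty_poweRy; rewrite invr_neq0// gt_eqF.
Qed.

Lemma le_lnorm q x y : 0 < q -> (forall n, normc (x n) <= normc (y n)) ->
  (lnorm q x <= lnorm q y)%E.
Proof.
move=> q0 xy; rewrite !lnormE//.
have s0 z : (0 <= \sum_(k <oo) (normc (z k) `^ q)%:E)%E.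
  by apply: nneseries_ge0 => k _ _.
apply: gt0_ler_poweR; rewrite ?invr_ge0 ?(ltW q0)// ?in_itv/= ?s0 ?leey//.
apply: lee_nneseries => k _ //; rewrite lee_fin.
by rewrite ge0_ler_powR ?nnegrE ?normc_ge0// ltW.
Qed.

Lemma lnorm_add q x y z : 1 < q ->
  (forall n, normc (z n) <= normc (x n) + normc (y n)) ->
  (lnorm q z <= lnorm q x + lnorm q y)%E.
Proof.
move=> q1 zxy; have q0 : 0 < q by rewrite (lt_trans _ q1).
pose w : omega R := fun n => (normc (x n) + normc (y n))%:C.
have wE n : normc (w n) = normc (x n) + normc (y n).
  by rewrite normc_real ger0_norm// addr_ge0// normc_ge0.
apply: (@le_trans _ _ (lnorm q w)); first by apply: le_lnorm => // n; rewrite wE.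
have -> : lnorm q w =
    Lnorm counting q%:E (EFin \o ((fun n => normc (x n)) \+ (fun n => normc (y n)))).
  by rewrite /lnorm; congr Lnorm; apply/funext => n; rewrite wE.
by apply: minkowski_EFin; rewrite ?ltW//.
Qed.

Lemma lnorm_scale q x z a : 1 < q -> 0 <= a ->
  (forall n, normc (z n) = a * normc (x n)) ->
  (lnorm q z = a%:E * lnorm q x)%E.
Proof.
move=> q1 a0 zE; have q0 : 0 < q by rewrite (lt_trans _ q1).
rewrite !lnormE//; under eq_eseriesr do rewrite zE powRM ?normc_ge0// EFinM.
rewrite nneseriesZl; last by move=> i _; exact: nneg_terms.
have S0 : (0 <= \sum_(k <oo) (normc (x k) `^ q)%:E)%E.
  by apply: nneseries_ge0 => k _ _.
rewrite poweRM ?lee_fin ?powR_ge0//.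
by rewrite poweR_EFin -powRrM mulfV ?gt_eqF// powRr1.
Qed.

Lemma lnorm_eq0 q x : 0 < q -> lnorm q x = 0%E -> x = 0.
Proof.
move=> q0; rewrite lnormE// => /eqP; rewrite poweR_eq0; last first.
  by apply: nneseries_ge0 => k _ _.
move=> /andP[/eqP s0 _]; apply/funext => k.
have := @nneseries_lim_ge R _ xpredT 0%N k.+1 (fun n _ _ => nneg_terms q x n).
rewrite s0 big_mkord big_ord_recr/= => le0.
have : ((normc (x k) `^ q)%:E <= 0)%E.
  by apply: le_trans le0; rewrite leeDr// sume_ge0// => i _; exact: nneg_terms.
rewrite lee_fin => le0'; apply: eq0_normc; apply/eqP.
have : normc (x k) `^ q == 0 by rewrite eq_le le0' powR_ge0.
by rewrite powR_eq0 => /andP[].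
Qed.

Lemma lnorm_sub p q x : 0 < p -> p <= q ->
  (lnorm p x < +oo)%E -> (lnorm q x < +oo)%E.
Proof.
move=> p0 pq; have q0 : 0 < q by exact: lt_le_trans pq.
rewrite !lnorm_lty// => sp.
set S := (\sum_(k <oo) _)%E in sp.
have S0 : (0 <= S)%E by apply: nneseries_ge0 => k _ _.
have Sk k : ((normc (x k) `^ p)%:E <= S)%E.
  have := @nneseries_lim_ge R _ xpredT 0%N k.+1 (fun n _ _ => nneg_terms p x n).
  apply: le_trans; rewrite big_mkord big_ord_recr/= leeDr//.
  by rewrite sume_ge0// => i _; exact: nneg_terms.
have Sfin : S \is a fin_num by rewrite ge0_fin_numE.
pose M := fine S `^ (q / p - 1).
apply: (@le_lt_trans _ _ (\sum_(k <oo) (M%:E * (normc (x k) `^ p)%:E))%E).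
  apply: lee_nneseries => k _ //.
  rewrite -EFinM lee_fin.
  have -> : normc (x k) `^ q = (normc (x k) `^ p) `^ (q / p).
    by rewrite -powRrM mulrC divfK// gt_eqF.
  have := Sk k; rewrite -[in X in (_ <= X)%E -> _](fineK Sfin) lee_fin.
  move: (normc _ `^ p) (powR_ge0 (normc (x k)) p) => b b0 bS.
  have qp : 0 <= q / p - 1 by rewrite subr_ge0 ler_pdivlMr// mul1r.
  have [->|bN0] := eqVneq b 0.
    by rewrite mulr0 powR0// gt_eqF// divr_gt0.
  rewrite -{1}(subrK 1 (q / p)) powRD ?bN0 ?implybT// powRr1// ler_wpM2r//.
  by rewrite ge0_ler_powR ?nnegrE// (le_trans b0).
rewrite nneseriesZl; last by move=> i _; exact: nneg_terms.
by rewrite lte_mul_pinfty// lee_fin powR_ge0.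
Qed.

End norms.

(* selects l^q, ces(q) or d_q *)
Inductive seqkind := Ell | Ces | Dee.

Section steps.
Context (R : realType).
Implicit Types (f : seqkind) (q : R) (x y : omega R).

Definition ell q : set (omega R) := [set x | (lnorm q x < +oo)%E].

Definition ell_infty : set (omega R) :=
  [set x | exists M : R, forall n, normc (x n) <= M].

Definition ces q : set (omega R) := [set x | ell q (Cop 1 (sabs x))].

Definition dspace q : set (omega R) :=
  [set x | ell_infty x /\ ell q (tail_sup x)].

Definition step_set f q : set (omega R) :=
  match f with Ell => ell q | Ces => ces q | Dee => dspace q end.

Definition step_norm f q x : R :=
  match f with
  | Ell => fine (lnorm q x)
  | Ces => fine (lnorm q (Cop 1 (sabs x)))
  | Dee => fine (lnorm q (tail_sup x))
  end.

Let dom f x := if f is Dee then ell_infty x else True.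
Let maj f x : omega R :=
  match f with Ell => x | Ces => Cop 1 (sabs x) | Dee => tail_sup x end.

Let step_setE f q x : step_set f q x <-> dom f x /\ (lnorm q (maj f x) < +oo)%E.
Proof. by case: f; split=> // -[]. Qed.

Let step_normE f q x : step_norm f q x = fine (lnorm q (maj f x)).
Proof. by case: f. Qed.

Lemma Cop_sabsE x n : Cop 1 (sabs x) n =
  ((\sum_(i < n.+1) normc (x i)) / n.+1%:R)%:C.
Proof.
rewrite /Cop rmorphM/= fmorphV/= rmorph_nat rmorph_sum/=; congr (_ / _).
by apply: eq_bigr => i _; rewrite expr1n mul1r.
Qed.

Let normc_ces x n : normc (Cop 1 (sabs x) n) =
  (\sum_(i < n.+1) normc (x i)) / n.+1%:R.
Proof.
rewrite Cop_sabsE normc_real ger0_norm// divr_ge0// sumr_ge0// => i _.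
exact: normc_ge0.
Qed.

Lemma tail_has_sup x n : ell_infty x ->
  has_sup [set normc (x k) | k in [set k | (n <= k)%N]].
Proof.
case=> M xM; split; first by exists (normc (x n)), n => //=.
by exists M => _ [k _ <-].
Qed.

Lemma tail_ub x n k : ell_infty x -> (n <= k)%N ->
  normc (x k) <= sup [set normc (x k) | k in [set k | (n <= k)%N]].
Proof.
by move=> bx nk; apply: sup_upper_bound; [exact: tail_has_sup|exists k].
Qed.

Let normc_tail x n : ell_infty x -> normc (tail_sup x n) =
  sup [set normc (x k) | k in [set k | (n <= k)%N]].
Proof.
move=> bx; rewrite normc_real ger0_norm//.
exact: le_trans (normc_ge0 _) (tail_ub bx (leqnn n)).
Qed.

Let domD f x y : dom f x -> dom f y -> dom f (x + y).
Proof.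
case: f => //= -[M xM] [N yN]; exists (M + N) => n.
by rewrite (le_trans (ler_normcD _ _))// lerD.
Qed.

Let normcZ (a : R[i]) x n : normc ((a *: x) n) = normc a * normc (x n).
Proof. exact: normcM. Qed.

Let domZ f (a : R[i]) x : dom f x -> dom f (a *: x).
Proof.
case: f => //= -[M xM]; exists (normc a * M) => n.
by rewrite normcZ ler_wpM2l// normc_ge0.
Qed.

Let majD f x y n : dom f x -> dom f y ->
  normc (maj f (x + y) n) <= normc (maj f x n) + normc (maj f y n).
Proof.
case: f => [_ _|_ _|bx by_]; first exact: ler_normcD.
  rewrite !normc_ces -mulrDl ler_wpM2r ?invr_ge0// -big_split/=.
  by apply: ler_sum => i _; exact: ler_normcD.
rewrite !normc_tail//; last exact: (@domD Dee).
apply: ge_sup; first by exists (normc ((x + y) n)), n => /=.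
move=> _ [k /= nk <-]; rewrite (le_trans (ler_normcD _ _))// lerD//.
  exact: tail_ub.
exact: tail_ub.
Qed.

Let majZ f (a : R[i]) x n : dom f x ->
  normc (maj f (a *: x) n) = normc a * normc (maj f x n).
Proof.
case: f => [_|_|bx]; first exact: normcZ.
  rewrite !normc_ces mulrA mulr_sumr; congr (_ / _).
  by apply: eq_bigr => i _; exact: normcZ.
rewrite !normc_tail//; last exact: (@domZ Dee).
have [a0|a0] := eqVneq (normc a) 0.
  rewrite a0 mul0r; apply/eqP; rewrite eq_le; apply/andP; split.
    apply: ge_sup; first by exists (normc ((a *: x) n)), n => /=.
    by move=> _ [k /= nk <-]; rewrite normcZ a0 mul0r.
  apply: le_trans (normc_ge0 _) (tail_ub _ (leqnn n)).
  exact: (@domZ Dee).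
have {}a0 : 0 < normc a by rewrite lt_def a0 normc_ge0.
apply/eqP; rewrite eq_le; apply/andP; split.
  apply: ge_sup; first by exists (normc ((a *: x) n)), n => /=.
  by move=> _ [k /= nk <-]; rewrite normcZ ler_pM2l//; exact: tail_ub.
rewrite -ler_pdivlMl//.
apply: ge_sup; first by exists (normc (x n)), n => /=.
move=> _ [k /= nk <-]; rewrite ler_pdivlMl// -normcZ.
by apply: tail_ub => //; exact: (@domZ Dee).
Qed.

Let maj0 f x : dom f x -> maj f x = 0 -> x = 0.
Proof.
case: f => //= dx x0; apply/funext => n; apply: eq0_normc; apply/eqP.
  have : normc (Cop 1 (sabs x) n) = 0 by rewrite x0 normc0.
  rewrite normc_ces => /eqP; rewrite mulf_eq0 invr_eq0 pnatr_eq0 orbF.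
  rewrite psumr_eq0 => [/allP/(_ ord_max)|i _]; last exact: normc_ge0.
  by rewrite mem_index_enum => /(_ isT).
have : normc (tail_sup x n) = 0 by rewrite x0 normc0.
rewrite normc_tail// => s0.
by rewrite eq_le normc_ge0 andbT -s0 tail_ub.
Qed.

Lemma step_set_sub f p q : 0 < p -> p <= q -> step_set f p `<=` step_set f q.
Proof.
move=> p0 pq x /step_setE [dx lx]; apply/step_setE; split => //.
exact: lnorm_sub lx.
Qed.

Let step_fin f q x : step_set f q x -> lnorm q (maj f x) \is a fin_num.
Proof. by move=> /step_setE [_ lx]; rewrite ge0_fin_numE ?lnorm_ge0. Qed.

Lemma step_set0 f q : 1 < q -> step_set f q 0.
Proof.
move=> q1; have d0 : dom f 0 by case: f => //=; exists 0 => n; rewrite normc0.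
apply/step_setE; split => //.
have -> : lnorm q (maj f 0) = (0%:E * lnorm q (maj f 0%R))%E.
  apply: lnorm_scale => // n.
  by rewrite -{1}(scale0r (0 : omega R)) majZ// normc0.
by rewrite mul0e ltry.
Qed.

Lemma step_setD f q x y : 1 < q ->
  step_set f q x -> step_set f q y -> step_set f q (x + y).
Proof.
move=> q1 /step_setE [dx lx] /step_setE [dy ly].
apply/step_setE; split; first exact: domD.
apply: le_lt_trans (lte_add_pinfty lx ly).
by apply: lnorm_add => // n; exact: majD.
Qed.

Lemma step_setZ f q (a : R[i]) x : 1 < q ->
  step_set f q x -> step_set f q (a *: x).
Proof.
move=> q1 /step_setE [dx lx]; apply/step_setE; split; first exact: domZ.
rewrite (@lnorm_scale _ _ (maj f x) _ (normc a))// ?normc_ge0//.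
  by rewrite lte_mul_pinfty// ?lee_fin normc_ge0.
by move=> n; exact: majZ.
Qed.

Lemma step_normD f q x y : 1 < q -> step_set f q x -> step_set f q y ->
  step_norm f q (x + y) <= step_norm f q x + step_norm f q y.
Proof.
move=> q1 sx sy; have sxy := step_setD q1 sx sy.
rewrite !step_normE -fineD ?step_fin// fine_le ?fin_numD ?step_fin//.
have [dx _] := (step_setE _ _ _).1 sx; have [dy _] := (step_setE _ _ _).1 sy.
by apply: lnorm_add => // n; exact: majD.
Qed.

Lemma step_normZ f q (a : R[i]) x : 1 < q -> step_set f q x ->
  step_norm f q (a *: x) = normc a * step_norm f q x.
Proof.
move=> q1 sx; have [dx _] := (step_setE _ _ _).1 sx.
rewrite !step_normE (@lnorm_scale _ _ (maj f x) _ (normc a)) ?normc_ge0//.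
  by rewrite fineM ?step_fin.
by move=> n; exact: majZ.
Qed.

Lemma step_norm0 f q x : 1 < q -> step_set f q x -> step_norm f q x = 0 ->
  x = 0.
Proof.
move=> q1 sx; have [dx _] := (step_setE _ _ _).1 sx.
rewrite step_normE => n0; apply: (maj0 dx).
apply: (@lnorm_eq0 _ q); first by rewrite (lt_trans _ q1).
by rewrite -(fineK (step_fin sx)) n0.
Qed.

End steps.

Section banach_steps.
Context (R : realType) (f : seqkind) (q : R) (q1 : 1 < q).

(* q1 is a parameter because step_pred is a linear subspace only when 1 < q. *)
Definition step_pred : {pred omega R} :=
  let _ := q1 in mem (step_set f q).

Lemma step_submod_closed : submod_closed step_pred.
Proof.
split=> [|a x y]; rewrite !inE; first exact: step_set0.
by move=> sx sy; apply: step_setD => //; exact: step_setZ.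
Qed.

HB.instance Definition _ :=
  GRing.isSubmodClosed.Build R[i] (omega R) step_pred step_submod_closed.

(* the Banach space l^q, ces(q) or d_q, normed by step_norm *)
Record step_space : Type :=
  Step { step_val :> omega R; step_valP : step_val \in step_pred }.

HB.instance Definition _ := [isSub for step_val].
HB.instance Definition _ := [Choice of step_space by <:].
HB.instance Definition _ := [SubChoice_isSubLmodule of step_space by <:].

Let norm (x : step_space) : R[i] := (step_norm f q x)%:C.

Let stepP (x : step_space) : step_set f q x.
Proof. by have := step_valP x; rewrite inE. Qed.

Let normD x y : norm (x + y) <= norm x + norm y.
Proof. by rewrite -rmorphD/= lecR; exact: step_normD. Qed.

Let normZ (a : R[i]) x : norm (a *: x) = `|a| * norm x.
Proof. by rewrite /norm step_normZ// rmorphM. Qed.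

Let norm_eq0 x : norm x = 0 -> x = 0.
Proof.
by move=> /complexI x0; apply: val_inj; apply: (step_norm0 q1 (stepP x)).
Qed.

HB.instance Definition _ :=
  Lmodule_isNormed.Build R[i] step_space normD normZ norm_eq0.

Lemma step_space_normE (x : step_space) : `|x| = (step_norm f q x)%:C.
Proof. by []. Qed.

End banach_steps.

(* the sequences p_k that increase strictly to p in (1, p) *)
Record exponent_seq (R : realType) (p : \bar R) := ExponentSeq {
  expo :> nat -> R;
  expo_gt1 : forall k, 1 < expo k;
  expo_ltp : forall k, ((expo k)%:E < p)%E;
  expo_incr : forall k, expo k < expo k.+1;
  expo_cvg : (expo k)%:E @[k --> \oo] --> p
}.

Section lb_spaces.
Context (R : realType) (f : seqkind) (p : \bar R) (e : exponent_seq p).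

Lemma expo_mono m n : (m <= n)%N -> e m <= e n.
Proof.
have step k : e k <= e k.+1 by exact/ltW/expo_incr.
exact: (homo_leq (@lexx _ R) (@le_trans _ R) step).
Qed.

Definition lb_pred : {pred omega R} :=
  mem (\bigcup_k step_set f (e k)).

Lemma lb_submod_closed : submod_closed lb_pred.
Proof.
have e0 k : 0 < e k by exact: lt_trans (expo_gt1 e k).
split=> [|a x y].
  by rewrite inE; exists 0%N => //; apply: step_set0; exact: expo_gt1.
rewrite !inE => -[m _ xm] [n _ yn]; exists (maxn m n) => //.
apply: step_setD; first exact: expo_gt1.
  apply: step_setZ; first exact: expo_gt1.
  by apply: step_set_sub xm => //; rewrite expo_mono// leq_maxl.
by apply: step_set_sub yn => //; rewrite expo_mono// leq_maxr.
Qed.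

HB.instance Definition _ :=
  GRing.isSubmodClosed.Build R[i] (omega R) lb_pred lb_submod_closed.

Record lb_union : Type :=
  LBUnion { lb_val :> omega R; lb_valP : lb_val \in lb_pred }.

HB.instance Definition _ := [isSub for lb_val].
HB.instance Definition _ := [Choice of lb_union by <:].
HB.instance Definition _ := [SubChoice_isSubLmodule of lb_union by <:].

Lemma step_in_lb k (x : step_space f (expo_gt1 e k)) : (x : omega R) \in lb_pred.
Proof. by rewrite inE; exists k => //; have := step_valP x; rewrite inE. Qed.

Definition lb_in k (x : step_space f (expo_gt1 e k)) : lb_union :=
  LBUnion (step_in_lb x).

Lemma lb_in_linear k : linear (@lb_in k).
Proof. by move=> a x y; apply: val_inj. Qed.

HB.instance Definition _ k :=
  GRing.isLinear.Build R[i] _ _ _ (@lb_in k) (@lb_in_linear k).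

(* l(p-), ces(p-) or d(p-) *)
Definition lb_space : Type := indlim (@lb_in).

HB.instance Definition _ := Tvs.copy lb_space (indlim (@lb_in)).

Lemma lb_in_surj (x : lb_union) : exists k u, x = @lb_in k u.
Proof.
have := lb_valP x; rewrite inE => -[k _ xk].
have sx : (x : omega R) \in step_pred f (expo_gt1 e k) by rewrite inE.
by exists k, (Step sx); apply: val_inj.
Qed.

End lb_spaces.

Section contlin.
Context (K : numFieldType) (E : tvsType K).

Definition contlin_pred : {pred E -> E} :=
  mem [set T : E -> E | linear T /\ continuous T].

Lemma contlin_submod_closed : submod_closed contlin_pred.
Proof.
split=> [|a T U]; rewrite !inE.
  split=> [b x y|x]; first by rewrite /= scaler0 addr0.
  exact: (@cst_continuous E E 0).
move=> [lT cT] [lU cU]; split=> [b x y|x].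
  rewrite -[LHS]/(a *: T (b *: x + y) + U (b *: x + y)) lT lU.
  rewrite -[RHS]/(b *: (a *: T x + U x) + (a *: T y + U y)).
  by rewrite !scalerDr !scalerA [a * b]mulrC addrACA.
apply: (@continuous_comp _ _ _ (fun x => (a *: T x, U x)) (fun z => z.1 + z.2)).
  apply: cvg_pair => /=; last exact: cU.
  apply: (@continuous_comp E (K^o * E)%type E (fun x => (a, T x)) (fun z => z.1 *: z.2)).
    have ca : (fun _ : E => a : K^o) @ x --> (a : K^o) by exact: cvg_cst.
    exact: (cvg_pair ca (cT x)).
  exact: scale_continuous.
exact: add_continuous.
Qed.

HB.instance Definition _ :=
  GRing.isSubmodClosed.Build K (E -> E) contlin_pred contlin_submod_closed.

(* L(E), with the strong operator topology of L_s(E) *)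
Record contlin : Type :=
  ContLin { contlin_fun :> E -> E; contlinP : contlin_fun \in contlin_pred }.

HB.instance Definition _ := [isSub for contlin_fun].
HB.instance Definition _ := [Choice of contlin by <:].
HB.instance Definition _ := [SubChoice_isSubLmodule of contlin by <:].

HB.instance Definition _ := Topological.copy contlin
  (initial_topology (contlin_fun : contlin -> {ptws E -> E})).

Lemma contlin_id_subproof : idfun \in contlin_pred.
Proof. by rewrite inE; split=> // x; exact: cvg_id. Qed.

Definition contlin_id := ContLin contlin_id_subproof.

Lemma contlin_comp_subproof (T U : contlin) : T \o U \in contlin_pred.
Proof.
have := contlinP T; have := contlinP U; rewrite !inE => -[lU cU] [lT cT].
split=> [a x y|x] /=; first by rewrite lU lT.
by apply: continuous_comp; [exact: cU|exact: cT].
Qed.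

Definition contlin_comp (T U : contlin) := ContLin (contlin_comp_subproof T U).

Definition contlin_exp (T : contlin) (n : nat) :=
  iter n (contlin_comp T) contlin_id.

Lemma contlin_cvgP (F : set_system contlin) (T : contlin) : Filter F ->
  F --> T <-> forall x, (U : contlin) x @[U --> F] --> T x.
Proof.
move=> FF; pose i := contlin_fun : contlin -> {ptws E -> E}.
have -> : F --> T <-> i @ F --> i T.
  split=> [FT|FT A].
    exact: (cvg_comp _ _ FT (@initial_continuous _ _ i T)).
  rewrite nbhsE => -[_ [[B oB <-] BT] BA].
  by apply: (filterS BA); apply: FT; apply: open_nbhs_nbhs.
exact: pointwise_cvgP.
Qed.

End contlin.

(* T maps lb_space f e into itself and T' is its restriction, which is thus in *)
(* L(lb_space f e).                                                            *)
Definition restricts_to (R : realType) (f : seqkind) (p : \bar R)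
    (e : exponent_seq p) (T : omega R -> omega R)
    (T' : contlin (lb_space f e)) :=
  forall x : lb_space f e, lb_val (T' x) = T (lb_val x).

(* Main.v *)
Require Import Defs.
From HB Require Import structures.
From mathcomp Require Import all_boot all_order all_algebra.
From mathcomp Require Import all_classical all_reals all_analysis.
From mathcomp Require Import complex.
Import Order.TTheory GRing.Theory Num.Theory.
Import numFieldNormedType.Exports.
Import Normc.
Local Open Scope classical_set_scope.
Local Open Scope complex_scope.
Local Open Scope ring_scope.

(* Everything reduces to the geometric convolution geo s y n = \sum_(i <=    *)
(* n) s^(n - i) y_i. If |z| <= c geo s |x| pointwise with 0 <= s < 1, then   *)
(* ||z|| <= c (1 - s)^-2 ||x|| in each of l^q, ces(q) and d_q: in l^q        *)
(* because truncations w of geo s |x| satisfy w <= |x| + s S w and S is an   *)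
(* isometry; ces(q) and d_q reduce to l^q because the averages and the tail  *)
(* suprema of geo s |x| are at most (1 - s)^-1 times geo s of those of |x|.  *)
(* As R_t x = geo t x, this bounds R_t, S and D_phi on every step, hence C_t *)
(* = D_phi R_t. The remainder of the series is t^N S^N R_t x; with t < s < 1 *)
(* it is dominated by (t/s)^N geo s |R_t x|, so it tends to 0 in a single    *)
(* step.                                                                     *)

(** By [geoS], [geo s y] solves g = y + s S g, and M = (1 - s)^-1 A solves M = A + s M. Hence a
    bound of this form propagates by induction: this gives [lnorm_geo], [sum_geo] and [geo_tail],
    which [step_geo] combines into the bound on each step. [contlin_dominated] passes from the steps
    to the inductive limit by its universal property, and [lb_cvg] reduces convergence there to norm
    convergence in one step. [geo_partial_sum] telescopes the series; continuity of D_phi carries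
    its convergence over to C_t. *)

Section geometric_convolution.
Context {R : realType}.
Implicit Types (s c q : R) (x z w : omega R) (n : nat).

Definition geo {A : pzSemiRingType} (s : A) (y : nat -> A) (n : nat) : A :=
  \sum_(i < n.+1) s ^+ (n - i) * y i.

Lemma geo0 {A : pzSemiRingType} (s : A) (y : nat -> A) : geo s y 0 = y 0%N.
Proof. by rewrite /geo big_ord1 expr0 mul1r. Qed.

Lemma geoS {A : pzSemiRingType} (s : A) (y : nat -> A) n :
  geo s y n.+1 = y n.+1 + s * geo s y n.
Proof.
rewrite /geo big_ord_recr/= subnn expr0 mul1r addrC mulr_sumr; congr (_ + _).
by apply: eq_bigr => i _; rewrite subSn ?exprS ?mulrA// -ltnS.
Qed.

Lemma ler_geo s (y : nat -> R) n i : 0 <= s -> (forall n, 0 <= y n) ->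
  (i <= n)%N -> s ^+ (n - i) * y i <= geo s y n.
Proof.
move=> s0 y0; rewrite -ltnS => ilt; rewrite /geo (bigD1 (Ordinal ilt))//=.
by rewrite lerDl sumr_ge0// => j _; rewrite mulr_ge0 ?exprn_ge0.
Qed.

Lemma ler_geo1 s (y : nat -> R) n : 0 <= s -> (forall n, 0 <= y n) ->
  y n <= geo s y n.
Proof.
by move=> s0 y0; have := ler_geo _ _ _ _ s0 y0 (leqnn n); rewrite subnn mul1r.
Qed.

Lemma geo_ge0 s (y : nat -> R) n : 0 <= s -> (forall n, 0 <= y n) ->
  0 <= geo s y n.
Proof. by move=> s0 y0; apply: le_trans (y0 n) (ler_geo1 _ _ _ _ _). Qed.

Lemma normc_geo s x n : 0 <= s ->
  normc (geo s%:C x n) <= geo s (fun i => normc (x i)) n.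
Proof.
move=> s0; elim: n => [|n IHn]; first by rewrite !geo0.
rewrite !geoS (le_trans (ler_normcD _ _))// lerD2l normcM normc_real ger0_norm//.
exact: ler_wpM2l.
Qed.

Lemma geoZ s c (y : nat -> R) n : geo s (fun i => c * y i) n = c * geo s y n.
Proof.
by rewrite /geo mulr_sumr; apply: eq_bigr => i _; rewrite mulrCA.
Qed.

(** The fixed-point identity that closes each of the inductions below. *)
Lemma onem_inv s : s < 1 -> 1 + s * (1 - s)^-1 = (1 - s)^-1.
Proof.
move=> s1; have s0 : 1 - s != 0 by rewrite subr_eq0 gt_eqF.
by apply: (mulfI s0); rewrite mulrDr mulr1 mulrCA mulfV// mulr1 subrK.
Qed.

Lemma onem_inv_ge1 s : 0 <= s -> s < 1 -> 1 <= (1 - s)^-1.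
Proof.
by move=> s0 s1; rewrite -onem_inv// lerDl mulr_ge0// invr_ge0 subr_ge0 ltW.
Qed.

Lemma sum_geoS s (y : nat -> R) n :
  \sum_(k < n.+1) geo s y k = \sum_(k < n.+1) y k + s * \sum_(k < n) geo s y k.
Proof.
rewrite big_ord_recl geo0 [X in _ = X + _]big_ord_recl/= -addrA; congr (_ + _).
by rewrite mulr_sumr -big_split/=; apply: eq_bigr => i _; rewrite geoS.
Qed.

Lemma sum_geo s (y : nat -> R) n : 0 <= s -> s < 1 -> (forall n, 0 <= y n) ->
  \sum_(k < n.+1) geo s y k <= (1 - s)^-1 * \sum_(k < n.+1) y k.
Proof.
move=> s0 s1 y0; have c1 := onem_inv_ge1 _ s0 s1.
rewrite sum_geoS.
elim: n => [|n IHn].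
  by rewrite big_ord0 mulr0 addr0 big_ord1 ler_peMl.
rewrite -onem_inv// mulrDl mul1r lerD2l -mulrA ler_wpM2l//.
rewrite sum_geoS.
apply: le_trans IHn _; rewrite ler_wpM2l ?invr_ge0 ?subr_ge0 ?(ltW s1)//.
by rewrite [leRHS]big_ord_recr/= lerDl.
Qed.

(** Induction on k upwards from n: the new term z_(k+1) is at most y_n, hence at most [geo s y n],
    so the bound reproduces itself. It is used with y the tail suprema of z. *)
Lemma geo_tail s (y z : nat -> R) n k : 0 <= s -> s < 1 ->
  (forall n, 0 <= y n) -> (forall n k, (n <= k)%N -> z k <= y n) ->
  (n <= k)%N -> geo s z k <= (1 - s)^-1 * geo s y n.
Proof.
move=> s0 s1 y0 zy; have c1 := onem_inv_ge1 _ s0 s1.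
elim: k => [|k IHk].
  by rewrite leqn0 => /eqP->; rewrite !geo0 (le_trans (zy 0 0 _))// ler_peMl.
rewrite leq_eqVlt ltnS => /predU1P[->|nk].
  apply: (@le_trans _ _ (geo s y k.+1)).
    by apply: ler_sum => i _; rewrite ler_wpM2l ?exprn_ge0// zy.
  by rewrite ler_peMl// geo_ge0.
rewrite geoS -onem_inv// mulrDl mul1r lerD//.
  by rewrite (le_trans (zy n k.+1 _)) ?(leq_trans nk)// ler_geo1.
by rewrite -mulrA ler_wpM2l// IHk.
Qed.

(** A series of nonnegative terms is the limit of its partial sums. This permits an induction on
    truncations before the norm of the limit is known to be finite. *)
Lemma lnorm_trunc q z M : 0 < q ->
  (forall N, (lnorm q (fun n => if (n < N)%N then z n else 0%R) <= M)%E) ->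
  (lnorm q z <= M)%E.
Proof.
move=> q0 zM; have M0 := le_trans (lnorm_ge0 _ _) (zM 0%N).
have nn x k : (0 <= (normc (x k) `^ q)%:E)%E by rewrite lee_fin powR_ge0.
have sum0 x : (0 <= \sum_(k <oo) (normc (x k) `^ q)%:E)%E.
  by apply: nneseries_ge0.
have qV : 0 <= q^-1 by rewrite invr_ge0 ltW.
(* Writing M as (M^q)^(1/q) leaves the sum of q-th powers to compare with M^q. *)
rewrite lnormE// -[leRHS]poweRe1// -(mulfV (lt0r_neq0 q0)) poweRrM.
apply: gt0_ler_poweR; rewrite ?in_itv/= ?leey ?andbT ?poweR_ge0//.
apply: lime_le; first by apply: is_cvg_nneseries => k _ _; exact: nn.
apply: nearW => N.
pose v n := if (n < N)%N then z n else 0%R.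
apply: (@le_trans _ _ (lnorm q v `^ q)%E).
  rewrite lnormE// -poweRrM mulVf ?gt_eqF// poweRe1//.
  apply: le_trans (@nneseries_lim_ge R _ xpredT 0%N N (fun n _ _ => nn v n)).
  by rewrite !big_mkord lee_sum// => i _; rewrite /v ltn_ord.
apply: gt0_ler_poweR (zM N); rewrite ?(ltW q0)//= in_itv/= leey andbT//.
exact: lnorm_ge0.
Qed.

Lemma lnorm_Sop q z : 0 < q -> lnorm q (Sop z) = lnorm q z.
Proof.
move=> q0; rewrite !lnormE//; congr poweR.
rewrite nneseries_recl//; last by move=> k _; rewrite lee_fin powR_ge0.
rewrite (normc0 R : normc (Sop z 0) = 0) powR0 ?gt_eqF// add0e.
rewrite -(nneseries_addn 1)//; last by move=> i; rewrite lee_fin powR_ge0.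
by apply: eq_eseriesr => i _; rewrite addn1.
Qed.

(** Young's inequality for the kernel s^n, whose l^1 norm is (1 - s)^-1. *)
Lemma lnorm_geo s q x z : 1 < q -> 0 <= s -> s < 1 ->
  (forall n, normc (z n) <= geo s (fun i => normc (x i)) n) ->
  (lnorm q z <= (1 - s)^-1%:E * lnorm q x)%E.
Proof.
move=> q1 s0 s1 zx; have q0 : 0 < q by rewrite (lt_trans _ q1).
have c1 := onem_inv_ge1 _ s0 s1; have c0 := le_trans ler01 c1.
pose g := geo s (fun i => normc (x i)).
have g0 n : 0 <= g n by apply: geo_ge0 => // k; exact: normc_ge0.
apply: (@le_trans _ _ (lnorm q (fun n => (g n)%:C))).
  by apply: le_lnorm => // n; rewrite normc_real ger0_norm.
pose w N : omega R := fun n => if (n < N)%N then (g n)%:C else 0.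
apply: lnorm_trunc => //; rewrite -[forall N, _]/(forall N, (lnorm q (w N) <= _)%E).
elim=> [|N IHN].
  apply: le_trans (_ : _ <= lnorm q x)%E _.
    by apply: le_lnorm => // n; rewrite /w ltn0 normc0 normc_ge0.
  by rewrite lee_pemull ?lnorm_ge0 ?lee_fin.
(* w N.+1 <= |x| + s S (w N), and S is an isometry of l^q. *)
apply: (@le_trans _ _ (lnorm q x + lnorm q (s%:C *: Sop (w N)))%E).
  apply: lnorm_add => // n; rewrite normcM normc_real (ger0_norm s0).
  case: n => [|n].
    rewrite /w ltn0Sn (_ : Sop _ 0 = 0)// normc_real ger0_norm// normc0 mulr0.
    by rewrite addr0 /g geo0.
  rewrite (_ : Sop _ n.+1 = w N n)// /w ltnS; case: ltnP => nN.
    by rewrite !normc_real !ger0_norm ?g0// /g geoS.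
  by rewrite normc0 mulr0 addr0 normc_ge0.
rewrite (@lnorm_scale _ _ (Sop (w N)) (s%:C *: Sop (w N)) s)//; last first.
  by move=> n; rewrite normcM normc_real (ger0_norm s0).
rewrite lnorm_Sop// -onem_inv// EFinD ge0_muleDl ?lee_fin ?mulr_ge0// mul1e.
by rewrite leeD2l// EFinM -muleA lee_wpmul2l// lee_fin.
Qed.

End geometric_convolution.

(** * Domination in l^q, ces(q) and d_q *)

Section step_domination.
Context {R : realType} (f : seqkind) {q : R} (q1 : 1 < q).
Implicit Types (s c : R) (x z : omega R) (n : nat).

Let q0 : 0 < q. Proof. exact: lt_trans q1. Qed.

Lemma normc_Cop1_sabs x n :
  normc (Cop 1 (sabs x) n) = (\sum_(i < n.+1) normc (x i)) / n.+1%:R.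
Proof.
rewrite Cop_sabsE normc_real ger0_norm// divr_ge0// sumr_ge0// => i _.
exact: normc_ge0.
Qed.

Lemma normc_tail_sup x n : ell_infty x -> normc (tail_sup x n) =
  sup [set normc (x k) | k in [set k | (n <= k)%N]].
Proof.
move=> bx; rewrite normc_real ger0_norm//.
exact: le_trans (normc_ge0 _) (tail_ub bx (leqnn n)).
Qed.

(** One factor (1 - s)^-1 comes from [lnorm_geo], the other from passing to averages or tail
    suprema; for l^q the second is slack, which makes the constant uniform. *)
Lemma step_geo s x z : 0 <= s -> s < 1 -> step_set f q x ->
  (forall n, normc (z n) <= geo s (fun i => normc (x i)) n) ->
  step_set f q z /\ step_norm f q z <= (1 - s)^-1 ^+ 2 * step_norm f q x.
Proof.
move=> s0 s1 sx zx.
have c1 := onem_inv_ge1 _ s0 s1; have c0 := le_trans ler01 c1.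
have x0 n : 0 <= normc (x n) by exact: normc_ge0.
(* the three kinds only differ in the sequences u, v whose l^q norms are taken *)
have bound u v : (lnorm q v < +oo)%E ->
    (forall n, normc (u n) <= (1 - s)^-1 * geo s (fun i => normc (v i)) n) ->
    (lnorm q u < +oo)%E /\
    fine (lnorm q u) <= (1 - s)^-1 ^+ 2 * fine (lnorm q v).
  move=> fv uv.
  have cvE n : normc (((1 - s)^-1%:C *: v) n) = (1 - s)^-1 * normc (v n).
    by rewrite normcM normc_real ger0_norm.
  have : (lnorm q u <= ((1 - s)^-1 ^+ 2)%:E * lnorm q v)%E.
    rewrite expr2 EFinM -muleA -(lnorm_scale _ _ cvE)//.
    apply: lnorm_geo => // n; apply: le_trans (uv n) _.
    by rewrite -geoZ; apply: ler_sum => i _; rewrite cvE.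
  have vfin : lnorm q v \is a fin_num by rewrite ge0_fin_numE ?lnorm_ge0.
  rewrite -{1}(fineK vfin) -EFinM => le_u.
  have ufin : (lnorm q u < +oo)%E by apply: le_lt_trans le_u (ltry _).
  split=> //; rewrite -lee_fin fineK// ge0_fin_numE ?lnorm_ge0//.
case: f sx => [sx|sx|[bx sx]].
- apply: bound sx _ => n; apply: le_trans (zx n) _.
  by rewrite ler_peMl// geo_ge0.
- apply: bound sx _ => n.
  have a0 k : 0 <= normc (Cop 1 (sabs x) k) by exact: normc_ge0.
  apply: (@le_trans _ _ ((1 - s)^-1 * normc (Cop 1 (sabs x) n))); last first.
    by rewrite ler_wpM2l// ler_geo1.
  rewrite !normc_Cop1_sabs mulrA ler_wpM2r ?invr_ge0//.
  by apply: le_trans (sum_geo _ _ _ s0 s1 x0); exact: ler_sum.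
- pose y n := normc (tail_sup x n).
  have y0 n : 0 <= y n by exact: normc_ge0.
  have xy n k : (n <= k)%N -> normc (x k) <= y n.
    by move=> nk; rewrite /y normc_tail_sup//; exact: tail_ub.
  have zy n k : (n <= k)%N -> normc (z k) <= (1 - s)^-1 * geo s y n.
    by move=> nk; apply: le_trans (zx k) _; exact: geo_tail.
  have bz : ell_infty z by exists ((1 - s)^-1 * geo s y 0) => n; exact: zy.
  have [|fz nz] := bound (tail_sup z) (tail_sup x) sx; last by [].
  move=> n; rewrite normc_tail_sup//; apply: ge_sup.
    by exists (normc (z n)), n => /=.
  by move=> _ [k /= nk <-]; exact: zy.
Qed.

Lemma step_geoM s c x z : 0 <= s -> s < 1 -> 0 <= c -> step_set f q x ->
  (forall n, normc (z n) <= c * geo s (fun i => normc (x i)) n) ->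
  step_set f q z /\ step_norm f q z <= c * (1 - s)^-1 ^+ 2 * step_norm f q x.
Proof.
move=> s0 s1 c0 sx zx.
have := @step_geo s (c%:C *: x) z s0 s1 (step_setZ _ q1 sx).
rewrite step_normZ// normc_real ger0_norm// mulrCA mulrA; apply => n.
apply: le_trans (zx n) _; rewrite -geoZ; apply: ler_sum => i _.
by rewrite normcM normc_real ger0_norm.
Qed.

End step_domination.

(** * Coordinatewise identities for S and R_t *)

Section coordinates.
Context {R : realType}.
Implicit Types (t : R) (x y : omega R) (n N : nat).

Lemma Sop_linear : linear (@Sop R).
Proof.
move=> a x y; apply/funext => -[|n]//.
by rewrite -[RHS]/(a * 0 + 0) mulr0 addr0.
Qed.

Lemma Dop_linear : linear (@Dop R).
Proof.
move=> a x y; apply/funext => n.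
rewrite -[LHS]/((a * x n + y n) / _) -[RHS]/(a * (x n / _) + y n / _).
by rewrite mulrDl mulrA.
Qed.

Lemma geo_linear t : linear (geo t%:C : omega R -> omega R).
Proof.
move=> a x y; apply/funext => n.
rewrite -[RHS]/(a * geo _ x n + geo _ y n) /geo mulr_sumr -big_split/=.
apply: eq_bigr => i _; rewrite -[(a *: x + y) i]/(a * x i + y i).
by rewrite mulrDr mulrCA.
Qed.

Lemma iter_Sop_linear N : linear (iter N (@Sop R)).
Proof. by move=> a x y; elim: N => //= N ->; exact: Sop_linear. Qed.

Lemma iter_SopE N x n :
  iter N (@Sop R) x n = if (N <= n)%N then x (n - N)%N else 0.
Proof. by elim: N n => [|N IHN] [|n]//=; rewrite IHN. Qed.

Lemma geo_fixpoint t x : geo t%:C x = x + t%:C *: Sop (geo t%:C x).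
Proof.
apply/funext => -[|n]; first by rewrite geo0 -[RHS]/(x 0%N + t%:C * 0) mulr0 addr0.
by rewrite geoS.
Qed.

(** Telescoping: [geo_fixpoint] says (1 - tS) G = x for G = [geo t%:C x]. *)
Lemma geo_partial_sum t x N :
  \sum_(n < N) t%:C ^+ n *: iter n (@Sop R) x =
  geo t%:C x - t%:C ^+ N *: iter N (@Sop R) (geo t%:C x).
Proof.
elim: N => [|N IHN]; first by rewrite big_ord0 expr0 scale1r subrr.
rewrite big_ord_recr/= IHN {2}geo_fixpoint [x + _]addrC iter_Sop_linear -iterSr.
by rewrite iterS scalerDr scalerA exprSr opprD addrA subrK.
Qed.

Lemma RopE t x : Rop t x = geo t%:C x.
Proof.
apply: cvg_lim.
  exact: (@hausdorff_product nat (fun=> R[i]^o)) => n; exact: norm_hausdorff.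
apply/(@pointwise_cvgP nat R[i]^o) => n; apply: cvg_near_cst.
(* The remainder t^N S^N G vanishes at coordinate n as soon as N > n. *)
exists n.+1 => // N /= nN; rewrite geo_partial_sum.
rewrite -[LHS]/(geo t%:C x n - t%:C ^+ N * iter N _ _ n) iter_SopE leqNgt nN.
by rewrite mulr0 subr0.
Qed.

End coordinates.

(** * Convergence and continuity in the (LB)-space *)

Section lb_operators.
Context {R : realType} (f : seqkind) {p : \bar R} (e : exponent_seq p).

(** A basic neighbourhood of 0 in the limit pulls back to a neighbourhood of 0 in step k, and only
    the differences have to lie in that step. *)
Lemma lb_cvg k (y : nat -> lb_space f e) (l : lb_space f e) :
  (forall N, step_set f (e k) (lb_val (y N) - lb_val l)) ->
  step_norm f (e k) (lb_val (y N) - lb_val l) @[N --> \oo] --> (0 : R) ->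
  y @ \oo --> l.
Proof.
move=> sd d0 A [W [_ _ nW] WA].
pose d N : step_space f (expo_gt1 e k) := Step (mem_set (sd N)).
have dcvg : d @ \oo --> 0.
  (* A positive [eps] in [R[i]] is real, so the estimate is one between real parts. *)
  apply/cvgr0Pnorm_lt => eps; rewrite ltcE/= => /andP[/eqP im0 re0].
  have /cvgr0Pnorm_lt/(_ _ re0) := d0; apply: filterS => N /=.
  move=> /(le_lt_trans (ler_norm _)) lt_re.
  by rewrite step_space_normE ltcE/= im0 eqxx.
have near_W : \forall N \near \oo, W (lb_in (d N)) := dcvg _ (nW k).
rewrite -[_ A]/(\forall N \near \oo, A (y N)).
apply: filterS near_W => N WN.
have -> : y N = l + lb_in (d N) by apply: val_inj; rewrite /= addrC subrK.
exact: WA.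
Qed.

Lemma contlin_dominated (T : omega R -> omega R) (s c : R) : linear T ->
  0 <= s -> s < 1 -> 0 <= c ->
  (forall x n, normc (T x n) <= c * geo s (fun i => normc (x i)) n) ->
  exists T' : contlin (lb_space f e), restricts_to T T'.
Proof.
move=> lT s0 s1 c0 Tx; pose C := c * (1 - s)^-1 ^+ 2.
have C0 : 0 <= C by rewrite mulr_ge0// exprn_ge0// invr_ge0 subr_ge0 ltW.
have step k x : step_set f (e k) x -> step_set f (e k) (T x) /\
    step_norm f (e k) (T x) <= C * step_norm f (e k) x.
  by move=> sx; exact: (step_geoM f (expo_gt1 e k) s c x _ s0 s1 c0 sx (Tx x)).
have lbT (x : lb_union f e) : T x \in lb_pred f e.
  by have := lb_valP x; rewrite !inE => -[k _ /step[sTx _]]; exists k.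
pose U (x : lb_union f e) : lb_space f e := LBUnion (lbT x).
have lU : linear U by move=> a x y; apply: val_inj; exact: lT.
pose U' : {linear lb_union f e -> lb_space f e} :=
  HB.pack U (GRing.isLinear.Build _ _ _ _ U lU).
have cU : continuous (U : lb_space f e -> lb_space f e).
  (* Continuity on the limit is continuity on each step, where [T] maps step k boundedly into
     itself. *)
  apply: (@indlim_continuous _ _ _ (@lb_in R f p e) _ U') => [v|k].
    exact: lb_in_surj.
  have sT (x : step_space f (expo_gt1 e k)) : T x \in step_pred f (expo_gt1 e k).
    by have := step_valP x; rewrite !inE => /step[].
  pose V x : step_space f (expo_gt1 e k) := Step (sT x).
  have lV : linear V by move=> a x y; apply: val_inj; exact: lT.
  pose V' : {linear _ -> _} := HB.pack V (GRing.isLinear.Build _ _ _ _ V lV).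
  have cV : continuous V'.
    apply: bounded_linear_continuous; apply/linear_boundedP.
    exists C%:C; split=> [|r Cr x]; first by rewrite ger0_real// ler0c.
    apply: (@le_trans _ _ (C%:C * `|x|)).
      rewrite !step_space_normE -rmorphM lecR.
      by have /step[] : step_set f (e k) x by have := step_valP x; rewrite inE.
    by rewrite ler_wpM2r// ltW.
  have -> : U' \o @lb_in R f p e k = @lb_in R f p e k \o V.
    by apply/funext => x; apply: val_inj.
  move=> x; apply: (@continuous_comp _ _ (lb_space f e)); first exact: cV.
  exact: (@indlim_in_continuous _ _ _ (@lb_in R f p e)).
have UP : (U : lb_space f e -> lb_space f e) \in @contlin_pred _ (lb_space f e).
  by rewrite inE.
by exists (ContLin UP).
Qed.

Lemma contlin_sumE (a : nat -> R[i]) (A : nat -> contlin (lb_space f e)) N x :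
  lb_val ((\sum_(n < N) a n *: A n : contlin (lb_space f e)) x) =
  \sum_(n < N) a n *: lb_val (A n x).
Proof. by elim: N => [|N IHN]; rewrite ?big_ord0// !big_ord_recr/= -IHN. Qed.

Lemma contlin_expE (SX : contlin (lb_space f e)) n x : restricts_to (@Sop R) SX ->
  lb_val (contlin_exp SX n x) = iter n (@Sop R) (lb_val x).
Proof. by move=> SXE; elim: n => //= n IHn; rewrite SXE IHn. Qed.

End lb_operators.

(** * Remainder estimate and composition with D_phi *)

Lemma step_iter_Sop {R : realType} (f : seqkind) (q t s : R) (x : omega R) N :
  1 < q -> 0 <= t -> t < s -> s < 1 -> step_set f q x ->
  step_set f q (t%:C ^+ N *: iter N (@Sop R) x) /\
  step_norm f q (t%:C ^+ N *: iter N (@Sop R) x) <=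
    (t / s) ^+ N * (1 - s)^-1 ^+ 2 * step_norm f q x.
Proof.
move=> q1 t0 ts s1 sx; have s0 : 0 < s by exact: le_lt_trans ts.
apply: step_geoM sx _ => //; rewrite ?(ltW s0)// ?exprn_ge0 ?divr_ge0 ?(ltW s0)//.
move=> n; rewrite -[(_ *: _) n]/(t%:C ^+ N * iter N (@Sop R) x n) iter_SopE.
have g0 m : 0 <= geo s (fun i => normc (x i)) m.
  by apply: geo_ge0 => [|i]; [exact: ltW|exact: normc_ge0].
have ts0 : 0 <= (t / s) ^+ N by rewrite exprn_ge0// divr_ge0 ?(ltW s0).
case: leqP => [Nn|_]; last by rewrite mulr0 normc0 mulr_ge0.
rewrite normcM -rmorphXn normc_real ger0_norm ?exprn_ge0//.
(* t^N = (t/s)^N s^N, and s^N |x_(n-N)| is a single term of [geo s] of |x| at n. *)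
rewrite -{1}(divfK (lt0r_neq0 s0) t) exprMn -mulrA ler_wpM2l//.
rewrite -{1}(subKn Nn) ler_geo ?leq_subr ?(ltW s0)// => i.
exact: normc_ge0.
Qed.

Lemma step_norm_ge0 {R : realType} (f : seqkind) (q : R) (x : omega R) :
  0 <= step_norm f q x.
Proof. by case: f; apply: fine_ge0; exact: lnorm_ge0. Qed.

Lemma contlin_comp_sum {K : numFieldType} {E : tvsType K} (D : contlin E)
    (a : nat -> K) (A : nat -> contlin E) N x :
  (\sum_(n < N) a n *: contlin_comp D (A n)) x = D ((\sum_(n < N) a n *: A n) x).
Proof.
have [lD _] : linear D /\ continuous D by have := contlinP D; rewrite inE.
elim: N => [|N IHN].
  rewrite !big_ord0; apply/esym.
  by have := lD (-1) 0 0; rewrite scaler0 addr0 scaleN1r addNr.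
rewrite !big_ord_recr/= addrC [in RHS]addrC.
rewrite -[LHS]/(a N *: D (A N x) + (\sum_(n < N) a n *: contlin_comp D (A n)) x).
by rewrite IHN -lD.
Qed.

Theorem proposition5p2 (R : realType) (t : R) (f : seqkind) (p : \bar R)
    (e : exponent_seq p) :
  0 <= t -> t < 1 -> (1 < p)%E ->
  exists SX CX RX DX : contlin (lb_space f e),
    [/\ (* (i) *) restricts_to (@Sop R) SX,
        (* (ii) *) restricts_to (Cop t) CX,
        (* (iii) *) restricts_to (Rop t) RX,
        (fun N => \sum_(n < N) t%:C ^+ n *: contlin_exp SX n) @ \oo --> RX &
        [/\ restricts_to (@Dop R) DX,
            CX = contlin_comp DX RX &
            (fun N => \sum_(n < N) t%:C ^+ n *: contlin_comp DX (contlin_exp SX n))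
              @ \oo --> CX]].
Proof.
move=> t0 t1 _.
have norm0 (x : omega R) i : 0 <= normc (x i) by exact: normc_ge0.
have half0 : 0 <= 2^-1 :> R by rewrite invr_ge0.
have half1 : 2^-1 < 1 :> R by rewrite invf_lt1// ltr1n.
(* The constant 2 cancels the weight 1/2 that the convolution gives to x_(n-1). *)
have [||SX SXE] := contlin_dominated f e (@Sop R) _ 2 Sop_linear half0 half1.
- by [].
- move=> x [|n]; first by rewrite normc0 mulr_ge0 ?geo_ge0.
  rewrite geoS mulrDr mulrA mulfV ?pnatr_eq0// mul1r.
  by rewrite (le_trans (ler_geo1 _ _ _ half0 (norm0 x)))// lerDr mulr_ge0.
have [||DX DXE] := contlin_dominated f e (@Dop R) _ 1 Dop_linear half0 half1.
- by [].
- move=> x n; rewrite mul1r; apply: le_trans (ler_geo1 _ _ _ half0 (norm0 x)).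
  have n1 : n.+1%:R^-1 = (n.+1%:R^-1 : R)%:C by rewrite fmorphV rmorph_nat.
  rewrite normcM n1 normc_real ger0_norm ?invr_ge0// ler_piMr//.
  by rewrite invf_le1 ?ltr0Sn// ler1n.
have [||RX RXE] := contlin_dominated f e _ _ 1 (geo_linear t) t0 t1.
- by [].
- by move=> x n; rewrite mul1r normc_geo.
have partial x N :
    lb_val ((\sum_(n < N) t%:C ^+ n *: contlin_exp SX n) x) - lb_val (RX x) =
    - (t%:C ^+ N *: iter N (@Sop R) (lb_val (RX x))).
  rewrite (contlin_sumE _ _ (fun n => t%:C ^+ n) (contlin_exp SX)).
  under eq_bigr do rewrite (contlin_expE _ _ _ _ _ SXE).
  by rewrite geo_partial_sum RXE addrC addKr.
have RXcvg : (fun N => \sum_(n < N) t%:C ^+ n *: contlin_exp SX n) @ \oo --> RX.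
  apply/contlin_cvgP => x.
  have [k _ sx] : (\bigcup_k step_set f (e k)) (lb_val (RX x)).
    by have := lb_valP (RX x); rewrite inE.
  (* Any s strictly between t and 1 gives the geometric decay (t/s)^N. *)
  pose s := (t + 1) / 2.
  have ts : t < s by rewrite /s midf_lt.
  have s1 : s < 1 by rewrite /s midf_lt.
  have s0 : 0 < s by exact: le_lt_trans ts.
  have sN N := step_iter_Sop f (e k) t s _ N (expo_gt1 e k) t0 ts s1 sx.
  have negE y : - y = (-1) *: y :> omega R by rewrite scaleN1r.
  apply: (lb_cvg _ _ k) => [N|].
    rewrite partial negE; apply: step_setZ; first exact: expo_gt1.
    by have [] := sN N.
  pose a := (1 - s)^-1 ^+ 2 * step_norm f (e k) (lb_val (RX x)).
  apply: (@squeeze_cvgr _ _ _ _ (cst 0) (geometric a (t / s))).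
  - apply: nearW => N; rewrite partial negE step_normZ ?expo_gt1//; last first.
      by have [] := sN N.
    rewrite normcN normc1 mul1r.
    have [_ le_sN] := sN N.
    apply/andP; split.
      exact: step_norm_ge0.
    by rewrite /geometric/= /a mulrC mulrA.
  - exact: cvg_cst.
  - apply: cvg_geometric; rewrite ger0_norm ?divr_ge0 ?addr_ge0//.
    by rewrite ltr_pdivrMr// mul1r.
exists SX, (contlin_comp DX RX), RX, DX; split=> //.
(* [Cop t x] is by definition [Dop] applied to [geo t%:C x]. *)
- by move=> x; rewrite [LHS]DXE RXE.
- by move=> x; rewrite RopE.
(* The continuous map [DX] is applied pointwise to the convergent series of [RX]. *)
split=> //; apply/contlin_cvgP => x.
have [_ cDX] : linear DX /\ continuous DX by have := contlinP DX; rewrite inE.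
have sumE N := contlin_comp_sum DX (fun n => t%:C ^+ n) (contlin_exp SX) N x.
rewrite -[_ --> _]/((fun N => (\sum_(n < N) t%:C ^+ n *:
  contlin_comp DX (contlin_exp SX n)) x) @ \oo --> DX (RX x)) (funext sumE).
have /contlin_cvgP/(_ x) RXx := RXcvg.
exact: (cvg_comp _ _ RXx (cDX (RX x))).
Qed.
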